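(* Let $\mathcal{L}$ be one of the logics $\mathsf{M5},\mathsf{MP5},\mathsf{M45},\mathsf{MP45},\mathsf{MD45},\mathsf{K45},\mathsf{KD45}$. Then the linear nested sequent calculus $\mathsf{LNS}_{\mathcal{L}}$ extended with contraction and weakening is sound and complete for $\mathcal{L}$: for every formula $A$, $A\in\mathcal{L}$ if and only if $\;\Rightarrow A$ is derivable in this calculus.
   Context: Formulas: propositional variables, $\bot,\top,\neg,\land,\lor,\to,\Box$. For a set $\mathcal{A}$ of axiom names, $\mathsf{M}\mathcal{A}$ is the smallest set of formulas containing all propositional tautologies, the axiom $\Box(A\land B)\to(\Box A\land\Box B)$ and the axioms in $\mathcal{A}$, closed under modus ponens and the rule: from $A\to B$ and $B\to A$ infer $\Box A\to\Box B$; axioms: $\mathsf{C}: (\Box A\land\Box B)\to\Box(A\land B)$, $\mathsf{N}: \Box\top$, $\mathsf{P}: \neg\Box\bot$, $\mathsf{D}: \neg(\Box A\land\Box\neg A)$, $\mathsf{4}: \Box A\to\Box\Box A$, $\mathsf{5}: \Box A\lor\Box\neg\Box A$. The logics are $\mathsf{M5}=\mathsf{M}\{\mathsf 5\}$, $\mathsf{MP5}=\mathsf{M}\{\mathsf P,\mathsf 5\}$, $\mathsf{M45}=\mathsf{M}\{\mathsf 4,\mathsf 5\}$, $\mathsf{MP45}=\mathsf{M}\{\mathsf P,\mathsf 4,\mathsf 5\}$, $\mathsf{MD45}=\mathsf{M}\{\mathsf D,\mathsf 4,\mathsf 5\}$, $\mathsf{K45}=\mathsf{M}\{\mathsf N,\mathsf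 C,\mathsf 4,\mathsf 5\}$, $\mathsf{KD45}=\mathsf{M}\{\mathsf N,\mathsf C,\mathsf D,\mathsf 4,\mathsf 5\}$; $\mathsf{LNS}_{\mathcal{L}}$ for $\mathcal{L}=\mathsf{M}\mathcal{A}$ is the calculus with rules $\Box^{\mathsf m}_R,\Box^{\mathsf m}_L$ and the rules named by the elements of $\mathcal{A}$. Structures: $\mathcal{X}::=\Gamma\Rightarrow\Delta\mid\Gamma\Rightarrow\Delta\,/_{\mathsf m}\,\Sigma\Rightarrow\Pi\mid\Gamma\Rightarrow\Delta\,/\,\mathcal{X}$ (finite multisets; $/_{\mathsf m}$ only at the end). $\mathcal{S}\{\cdot\}$ marks a component; in rules below displayed components are the last ones and $\mathcal{G}$ is a possibly empty prefix. Propositional rules: zero-premiss $\mathcal{S}\{\Gamma,p\Rightarrow p,\Delta\}$ ($p$ atomic), $\mathcal{S}\{\Gamma,\bot\Rightarrow\Delta\}$, $\mathcal{S}\{\Gamma\Rightarrow\top,\Delta\}$ and the standard two-sided invertible rules for $\neg,\land,\lor,\to$ on one component, not applicable to the component after $/_{\mathsf m}$. $\Box^{\mathsf m}_R$: $\mathcal{G}/\Gamma\Rightarrow\Delta/_{\mathsf m}\Rightarrow B$ / $\mathcal{G}/\Gamma\Rightarrow\Box B,\Delta$; $\Box^{\mathsf m}_L$: $\mathcal{G}/\Gamma\Rightarrow\Delta/\Sigma,A\Rightarrow\Pi$ / $\mathcal{G}/\Gamma,\Box A\Rightarrow\Delta/_{\mathsf m}\Sigma\Rightarrow\Pi$; $\mathsf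 C$: $\mathcal{G}/_{\mathsf m}\Gamma\Rightarrow\Delta$ / $\mathcal{G}/\Gamma\Rightarrow\Delta$; $\mathsf N$: $\mathcal{G}/\Gamma\Rightarrow\Delta$ / $\mathcal{G}/_{\mathsf m}\Gamma\Rightarrow\Delta$; $\mathsf P$: $\mathcal{G}/\Gamma\Rightarrow\Delta/_{\mathsf m}\Rightarrow$ / $\mathcal{G}/\Gamma\Rightarrow\Delta$; $\mathsf D$: $\mathcal{G}/\Gamma\Rightarrow\Delta/_{\mathsf m}A\Rightarrow$ / $\mathcal{G}/\Gamma,\Box A\Rightarrow\Delta$; $\mathsf 4$: $\mathcal{G}/\Gamma\Rightarrow\Delta/\Sigma,\Box A\Rightarrow\Pi$ / $\mathcal{G}/\Gamma,\Box A\Rightarrow\Delta/_{\mathsf m}\Sigma\Rightarrow\Pi$; $\mathsf 5$: $\mathcal{G}/\Gamma\Rightarrow\Delta/\Sigma\Rightarrow\Pi,\Box A$ / $\mathcal{G}/\Gamma\Rightarrow\Delta,\Box A/_{\mathsf m}\Sigma\Rightarrow\Pi$. Contraction and weakening: usual left/right rules inside a component. *)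

(* Defs.v *)
From Stdlib Require List.
From HB Require Import structures.
From mathcomp Require Import all_boot.
From mathcomp Require Import finmap multiset.

Set Implicit Arguments.
Unset Strict Implicit.
Unset Printing Implicit Defensive.

Open Scope mset_scope.

Inductive formula : Type :=
| Var of nat
| Bot
| Top
| Neg of formula
| And of formula & formula
| Or of formula & formula
| Imp of formula & formula
| Box of formula.

(* Encoding into generic trees; it only serves to make [formula] a choiceType,
   as required to form [{mset formula}]. *)
Fixpoint formula_encode (A : formula) : GenTree.tree nat :=
  match A with
  | Var p => GenTree.Leaf p
  | Bot => GenTree.Node 0 [::]
  | Top => GenTree.Node 1 [::]
  | Neg A => GenTree.Node 2 [:: formula_encode A]
  | And A B => GenTree.Node 3 [:: formula_encode A; formula_encode B]
  | Or A B => GenTree.Node 4 [:: formula_encode A; formula_encode B]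
  | Imp A B => GenTree.Node 5 [:: formula_encode A; formula_encode B]
  | Box A => GenTree.Node 6 [:: formula_encode A]
  end.

Fixpoint formula_decode (t : GenTree.tree nat) : formula :=
  match t with
  | GenTree.Leaf p => Var p
  | GenTree.Node 1 [::] => Top
  | GenTree.Node 2 [:: a] => Neg (formula_decode a)
  | GenTree.Node 3 [:: a; b] => And (formula_decode a) (formula_decode b)
  | GenTree.Node 4 [:: a; b] => Or (formula_decode a) (formula_decode b)
  | GenTree.Node 5 [:: a; b] => Imp (formula_decode a) (formula_decode b)
  | GenTree.Node 6 [:: a] => Box (formula_decode a)
  | _ => Bot
  end.

Lemma formula_encodeK : cancel formula_encode formula_decode.
Proof. by elim=> //= [A ->|A -> B ->|A -> B ->|A -> B ->|A ->]. Qed.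

HB.instance Definition _ := Countable.copy formula (can_type formula_encodeK).

Inductive axiom_name : Type := AxC | AxN | AxP | AxD | Ax4 | Ax5.

Definition axiom_name_encode (a : axiom_name) : 'I_6 :=
  match a with
  | AxC => inord 0 | AxN => inord 1 | AxP => inord 2
  | AxD => inord 3 | Ax4 => inord 4 | Ax5 => inord 5
  end.

Definition axiom_name_decode (i : 'I_6) : axiom_name :=
  nth AxC [:: AxC; AxN; AxP; AxD; Ax4; Ax5] i.

Lemma axiom_name_encodeK : cancel axiom_name_encode axiom_name_decode.
Proof. by case; rewrite /axiom_name_decode /= inordK. Qed.

HB.instance Definition _ :=
  Finite.copy axiom_name (can_type axiom_name_encodeK).

(* Boolean evaluation in which variables and boxed formulas are the atoms. *)
Fixpoint beval (v : nat -> bool) (w : formula -> bool) (A : formula) : bool :=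
  match A with
  | Var p => v p
  | Bot => false
  | Top => true
  | Neg A => ~~ beval v w A
  | And A B => beval v w A && beval v w B
  | Or A B => beval v w A || beval v w B
  | Imp A B => beval v w A ==> beval v w B
  | Box A => w A
  end.

Definition tautology (A : formula) : Prop := forall v w, beval v w A.

Inductive axiom_instance : axiom_name -> formula -> Prop :=
| InstC A B : axiom_instance AxC (Imp (And (Box A) (Box B)) (Box (And A B)))
| InstN : axiom_instance AxN (Box Top)
| InstP : axiom_instance AxP (Neg (Box Bot))
| InstD A : axiom_instance AxD (Neg (And (Box A) (Box (Neg A))))
| Inst4 A : axiom_instance Ax4 (Imp (Box A) (Box (Box A)))
| Inst5 A : axiom_instance Ax5 (Or (Box A) (Box (Neg (Box A)))).

Inductive logic (L : {set axiom_name}) : formula -> Prop :=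
| LogTaut A : tautology A -> logic L A
| LogM A B : logic L (Imp (Box (And A B)) (And (Box A) (Box B)))
| LogAx a A : a \in L -> axiom_instance a A -> logic L A
| LogMP A B : logic L (Imp A B) -> logic L A -> logic L B
| LogCong A B :
    logic L (Imp A B) -> logic L (Imp B A) -> logic L (Imp (Box A) (Box B)).

Definition M5 : {set axiom_name} := [set Ax5].
Definition MP5 : {set axiom_name} := [set AxP; Ax5].
Definition M45 : {set axiom_name} := [set Ax4; Ax5].
Definition MP45 : {set axiom_name} := [set AxP; Ax4; Ax5].
Definition MD45 : {set axiom_name} := [set AxD; Ax4; Ax5].
Definition K45 : {set axiom_name} := [set AxN; AxC; Ax4; Ax5].
Definition KD45 : {set axiom_name} := [set AxN; AxC; AxD; Ax4; Ax5].

Inductive sequent : Type := Seq of {mset formula} & {mset formula}.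

Declare Scope lns_scope.
Notation "Gamma ⇒ Delta" := (Seq Gamma Delta) (at level 65) : lns_scope.
Open Scope lns_scope.

(* [Trans s t] is  s /_m t ;  [Next s X] is  s / X . *)
Inductive lns : Type :=
| Single of sequent
| Trans of sequent & sequent
| Next of sequent & lns.

(* [G // X] is  G / X  for a possibly empty prefix G. *)
Definition prefix (G : seq sequent) (X : lns) : lns := foldr Next X G.
Notation "G // X" := (prefix G X) (at level 68, right associativity) : lns_scope.

(* Linear nested sequents with one component replaced by a hole. *)
Inductive context : Type :=
| HoleEnd                         (* {}         *)
| HoleTrans of sequent            (* {} /_m t   *)
| HoleNext of lns                 (* {} / X     *)
| HoleBlocked of sequent          (* s /_m {}   *)
| CtxNext of sequent & context.   (* s / C{}    *)

Fixpoint fill (C : context) (s : sequent) : lns :=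
  match C with
  | HoleEnd => Single s
  | HoleTrans t => Trans s t
  | HoleNext X => Next s X
  | HoleBlocked t => Trans t s
  | CtxNext t C => Next t (fill C s)
  end.

Fixpoint blocked (C : context) : bool :=
  match C with
  | HoleBlocked _ => true
  | CtxNext _ C => blocked C
  | _ => false
  end.

Implicit Types (A B : formula) (G D : {mset formula}) (H : seq sequent).

Inductive prop_rule : seq sequent -> sequent -> Prop :=
| RInit p G D : prop_rule [::] (Var p +` G ⇒ Var p +` D)
| RBotL G D : prop_rule [::] (Bot +` G ⇒ D)
| RTopR G D : prop_rule [::] (G ⇒ Top +` D)
| RNegL A G D : prop_rule [:: G ⇒ A +` D] (Neg A +` G ⇒ D)
| RNegR A G D : prop_rule [:: A +` G ⇒ D] (G ⇒ Neg A +` D)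
| RAndL A B G D : prop_rule [:: A +` (B +` G) ⇒ D] (And A B +` G ⇒ D)
| RAndR A B G D :
    prop_rule [:: G ⇒ A +` D; G ⇒ B +` D] (G ⇒ And A B +` D)
| ROrL A B G D :
    prop_rule [:: A +` G ⇒ D; B +` G ⇒ D] (Or A B +` G ⇒ D)
| ROrR A B G D : prop_rule [:: G ⇒ A +` (B +` D)] (G ⇒ Or A B +` D)
| RImpL A B G D :
    prop_rule [:: G ⇒ A +` D; B +` G ⇒ D] (Imp A B +` G ⇒ D)
| RImpR A B G D : prop_rule [:: A +` G ⇒ B +` D] (G ⇒ Imp A B +` D).

Inductive struct_rule : sequent -> sequent -> Prop :=
| RContrL A G D : struct_rule (A +` (A +` G) ⇒ D) (A +` G ⇒ D)
| RContrR A G D : struct_rule (G ⇒ A +` (A +` D)) (G ⇒ A +` D)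
| RWeakL A G D : struct_rule (G ⇒ D) (A +` G ⇒ D)
| RWeakR A G D : struct_rule (G ⇒ D) (G ⇒ A +` D).

(* The rules named by the axioms, as relations between a premiss and a
   conclusion.  In C and N the structure with /_m must have a component before
   /_m , hence the component s. *)
Inductive axiom_rule : axiom_name -> lns -> lns -> Prop :=
| RC H s G D :
    axiom_rule AxC (H // Trans s (G ⇒ D))
                   (H // Next s (Single (G ⇒ D)))
| RN H s G D :
    axiom_rule AxN (H // Next s (Single (G ⇒ D)))
                   (H // Trans s (G ⇒ D))
| RP H G D :
    axiom_rule AxP (H // Trans (G ⇒ D) (mset0 ⇒ mset0))
                   (H // Single (G ⇒ D))
| RD H A G D :
    axiom_rule AxD (H // Trans (G ⇒ D) ([mset A] ⇒ mset0))
                   (H // Single (Box A +` G ⇒ D))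
| R4 H A G D G' D' :
    axiom_rule Ax4 (H // Next (G ⇒ D) (Single (Box A +` G' ⇒ D')))
                   (H // Trans (Box A +` G ⇒ D) (G' ⇒ D'))
| R5 H A G D G' D' :
    axiom_rule Ax5 (H // Next (G ⇒ D) (Single (G' ⇒ Box A +` D')))
                   (H // Trans (G ⇒ Box A +` D) (G' ⇒ D')).

(* A calculus, as a relation between lists of premisses and conclusions. *)
Definition rule_set := seq lns -> lns -> Prop.

Inductive LNS (L : {set axiom_name}) : rule_set :=
| LNSProp C ps c :
    ~~ blocked C -> prop_rule ps c -> LNS L [seq fill C p | p <- ps] (fill C c)
| LNSBoxR H B G D :
    LNS L [:: H // Trans (G ⇒ D) (mset0 ⇒ [mset B])]
          (H // Single (G ⇒ Box B +` D))
| LNSBoxL H A G D G' D' :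
    LNS L [:: H // Next (G ⇒ D) (Single (A +` G' ⇒ D'))]
          (H // Trans (Box A +` G ⇒ D) (G' ⇒ D'))
| LNSAx a X Y : a \in L -> axiom_rule a X Y -> LNS L [:: X] Y.

(* Contraction and weakening are allowed in every component, including the one
   after /_m . *)
Inductive with_struct (R : rule_set) : rule_set :=
| WSBase Xs Y : R Xs Y -> with_struct R Xs Y
| WSStruct C p c : struct_rule p c -> with_struct R [:: fill C p] (fill C c).

Inductive derivable (R : rule_set) : lns -> Prop :=
| Derive Xs Y :
    R Xs Y -> (forall X, List.In X Xs -> derivable R X) -> derivable R Y.

(* Main.v *)
Require Import Defs.
From mathcomp Require Import all_boot.
From mathcomp Require Import finmap multiset.
From mathcomp Require Import zify.

Set Implicit Arguments.
Unset Strict Implicit.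
Unset Printing Implicit Defensive.

(** Soundness: in presence of C (and N) the logic is normal, and a structure is
    read as a formula with nested boxes.  Without C, one shows instead that some
    component of a derivable structure is valid, where s /_m t counts as the
    single formula  s \/ Box t.

    Completeness: the logic is embedded in a two-sided sequent calculus with a
    single modal rule scheme, which satisfies cut elimination; cut is what gives
    modus ponens.  A modal inference of that calculus is simulated by one passage
    through a new last component, contraction providing the copies of the boxed
    formulas which the modal rules consume. *)

(** * A sequent calculus with cut elimination *)

(** The side condition of the modal rule measures one passage through a new component. Without C, a
    single use of Box_L, 4 or 5 ends the phase after [/_m], so that component receives the formula
    that opened it and one more: hence the bound 2, or 1 if P opened it empty. A cut removes a
    formula from each side, so the bound 2 survives it. The rule gives [Box Top] in every logic
    considered, rightly so: by 5, [Box A] or [Box (Neg (Box A))] holds, and monotonicity turns each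
    into [Box Top]. Soundness needs two readings. Nested boxes fail without C, because a two-premiss
    rule inside a box requires a conjunction of boxes to yield a box of the conjunction. Validity of
    a component fails with C, because that rule turns s \/ Box t into s / t, where neither s nor t
    need be valid. *)

(* [(true, A)] is an occurrence of [A] on the left, [(false, A)] on the right. *)
Definition signed : Type := (bool * formula)%type.

Definition box (x : signed) : signed := (x.1, Box x.2).

Definition decompose (x : signed) : option (seq (seq signed)) :=
  match x with
  | (true, Bot) | (false, Top) => Some [::]
  | (false, Bot) | (true, Top) => Some [:: [::]]
  | (b, Neg A) => Some [:: [:: (~~ b, A)]]
  | (true, And A B) => Some [:: [:: (true, A); (true, B)]]
  | (false, And A B) => Some [:: [:: (false, A)]; [:: (false, B)]]
  | (true, Or A B) => Some [:: [:: (true, A)]; [:: (true, B)]]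
  | (false, Or A B) => Some [:: [:: (false, A); (false, B)]]
  | (true, Imp A B) => Some [:: [:: (false, A)]; [:: (true, B)]]
  | (false, Imp A B) => Some [:: [:: (true, A); (false, B)]]
  | (_, Var _) | (_, Box _) => None
  end.

Definition pos (S : seq signed) := count (fun x => x.1) S.
Definition neg (S : seq signed) := count (fun x => ~~ x.1) S.

(* The modal rule infers  box U, box K  from  U, box K.  Without C at most two
   boxed formulas are principal; at most one formula is unboxed on the right, and
   none only if D or P starts the new component ([U] empty is plain weakening);
   boxed formulas are kept on the left by 4 and on the right by 5. *)
Definition allowed (L : {set axiom_name}) (U K : seq signed) : bool :=
  [&& (AxC \in L) || (pos U + neg U + (pos K + neg K) <= 2),
      neg U <= 1,
      [|| neg U == 1, AxD \in L, pos U + neg U == 0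
        | (AxP \in L) && (pos U + neg U + (pos K + neg K) <= 1)]
    & (Ax4 \in L) || (pos K == 0)].

Inductive der (L : {set axiom_name}) (S : seq signed) : Prop :=
| DerInit p : (true, Var p) \in S -> (false, Var p) \in S -> der L S
| DerProp x ps : x \in S -> decompose x = Some ps ->
    (forall q, q \in ps -> der L (q ++ S)) -> der L S
| DerModal U K : allowed L U K -> {subset map box (U ++ K) <= S} ->
    der L (U ++ map box K) -> der L S.

(** These conditions keep [allowed] closed under cut. If 5 keeps the cut formula on the right, the
    other formulas unboxed by the opposite inference become kept ones; with C or D some of them may
    be on the left, and 4 has to keep those. P is barred next to C because together they prove D,
    which the clause for P in [allowed] does not cover. N accompanies C because the simulation of
    several moves ends with N. *)
Definition regular (L : {set axiom_name}) : bool :=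
  [&& Ax5 \in L, (AxC \in L) == (AxN \in L), (AxC \in L) ==> (Ax4 \in L),
      (AxD \in L) ==> (Ax4 \in L) & (AxP \in L) ==> (AxC \notin L)].

(** * Weakening, contraction and inversion *)

Lemma der_weak L S T : {subset S <= T} -> der L S -> der L T.
Proof.
move=> sST d; elim: d T sST => {S}.
- by move=> S p h1 h2 T sST; apply: (@DerInit L T p); apply: sST.
- move=> S x ps xS e _ IH T sST; apply: (DerProp (sST _ xS) e) => q qps.
  apply: (IH q qps) => y; rewrite !mem_cat => /orP[->//|/sST ->].
  by rewrite orbT.
- move=> S U K a s d _ T sST; apply: (DerModal a _ d) => y /s; exact: sST.
Qed.

Lemma der_contr L x S : x \in S -> der L (x :: S) -> der L S.
Proof. by move=> xS; apply: der_weak => y; rewrite inE => /orP[/eqP->|]. Qed.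

Lemma mem_box S x : (box x \in map box S) = (x \in S).
Proof. by apply: mem_map => -[b A] [c B] [-> ->]. Qed.

Lemma der_invert L S x ps q : decompose x = Some ps -> q \in ps ->
  der L (x :: S) -> der L (q ++ S).
Proof.
move=> e qps d.
(* Inclusion in [x :: T] lets the induction remove all copies of [x] at once, including those which
   the cumulative rules keep in their premises. *)
suff H : forall S', der L S' -> forall T, {subset S' <= x :: T} ->
    {subset q <= T} -> der L T.
  apply: (H _ d) => y; rewrite ?inE mem_cat ?orbA ?inE; last by move=> ->.
  by case/orP=> [->//|->]; rewrite !orbT.
move=> {d S} S' d; elim: d => {S'}.
- move=> S p h1 h2 T sT _; apply: (@DerInit L T p).
    by move/sT: h1; rewrite inE => /orP[/eqP h|//]; rewrite -h in e.
  by move/sT: h2; rewrite inE => /orP[/eqP h|//]; rewrite -h in e.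
- move=> S y qs yS ey _ IH T sT sq.
  move/sT: (yS); rewrite inE => /orP[/eqP h|yT].
    rewrite h e in ey; case: ey => ?; subst qs.
    apply: (IH q) => // z; rewrite mem_cat => /orP[/sq zT|/sT//].
    by rewrite inE zT orbT.
  apply: (DerProp yT ey) => r rqs; apply: (IH r rqs) => z; rewrite ?mem_cat ?inE ?mem_cat.
    by move=> /orP[->|/sT]; rewrite ?orbT // inE => /orP[->|->]; rewrite ?orbT.
  by move/sq => ->; rewrite orbT.
- move=> S U K a s d _ T sT _; apply: (DerModal a _ d) => y yUK.
  move/s/sT: (yUK); rewrite inE => /orP[/eqP h|//].
  by case/mapP: yUK => -[b A] _ h'; rewrite -h h' in e; case: (b) e.
Qed.

(** * The modal case of cut *)

Definition drop_all (x : signed) (S : seq signed) := filter (predC1 x) S.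

Lemma mem_drop_all x S y : (y \in drop_all x S) = (y != x) && (y \in S).
Proof. by rewrite mem_filter. Qed.

Lemma pos_drop_all x S :
  pos S = pos (drop_all x S) + (if x.1 then count_mem x S else 0).
Proof.
elim: S => [|y S /= ->]; first by case: x.1.
case: (eqVneq y x) => [->|ne] /=; first by case: x.1; lia.
by case: x.1; rewrite ?addnA.
Qed.

Lemma neg_drop_all x S :
  neg S = neg (drop_all x S) + (if x.1 then 0 else count_mem x S).
Proof.
elim: S => [|y S /= ->]; first by case: x.1.
case: (eqVneq y x) => [->|ne] /=; first by case: x.1; lia.
by case: x.1; rewrite ?addnA.
Qed.

Lemma count_mem_if (x : signed) S : (x \in S) = (0 < count_mem x S).
Proof. by rewrite -has_pred1 has_count. Qed.

Lemma pos_cat S T : pos (S ++ T) = pos S + pos T.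
Proof. exact: count_cat. Qed.

Lemma neg_cat S T : neg (S ++ T) = neg S + neg T.
Proof. exact: count_cat. Qed.

(* Cut on [Box A] between two modal inferences.  [Box A] is first removed from
   each premise by a cut with the other conclusion; if [A] is unboxed on both
   sides, a cut on [A] follows. *)
Section ModalCut.

Variables (L : {set axiom_name}) (A : formula) (U1 K1 U2 K2 : seq signed).
Hypotheses (reg : regular L) (al1 : allowed L U1 K1) (al2 : allowed L U2 K2).

Let tA : signed := (true, A).
Let fA : signed := (false, A).
Let X := drop_all tA U1.
Let Y := drop_all fA U2.
(** The context kept by the first premise after [Box A] is cut from it: the opposite conclusion
    consists of boxed formulas, so what remains of it can enter as kept formulas. *)
Let K1' := drop_all tA K1 ++ if tA \in K1 then Y ++ drop_all fA K2 else [::].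
Let K2' := drop_all fA K2 ++ if fA \in K2 then X ++ drop_all tA K1 else [::].

Ltac count_boxes :=
  move: reg al1 al2; rewrite /regular /allowed /K1' /K2' /X /Y;
  rewrite !count_mem_if;
  have := pos_drop_all tA U1; have := neg_drop_all tA U1;
  have := pos_drop_all tA K1; have := neg_drop_all tA K1;
  have := pos_drop_all fA U2; have := neg_drop_all fA U2;
  have := pos_drop_all fA K2; have := neg_drop_all fA K2;
  rewrite /=;
  case: (AxC \in L); case: (AxD \in L) => //=;
  case: (Ax4 \in L) => //=; rewrite ?andbF //=; case: (AxP \in L);
  rewrite ?andbF //=;
  case: (posnP (count_mem tA K1)); move: (count_mem tA K1) => ? ?;
  case: (posnP (count_mem fA K2)); move: (count_mem fA K2) => ? ?;
  rewrite ?cats0 ?pos_cat ?neg_cat;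
  move: (pos U1) (neg U1) (pos K1) (neg K1) (pos U2) (neg U2) (pos K2) (neg K2);
  move: (pos (drop_all tA U1)) (neg (drop_all tA U1));
  move: (pos (drop_all tA K1)) (neg (drop_all tA K1));
  move: (pos (drop_all fA U2)) (neg (drop_all fA U2));
  move: (pos (drop_all fA K2)) (neg (drop_all fA K2));
  move: (count_mem tA U1) (count_mem fA U2) => *; lia.

Lemma allowed_cut_left :
  fA \in U2 ++ K2 -> tA \notin U1 -> tA \in K1 -> allowed L U1 K1'.
Proof. rewrite mem_cat; count_boxes. Qed.

Lemma allowed_cut_right :
  tA \in U1 ++ K1 -> fA \notin U2 -> fA \in K2 -> allowed L U2 K2'.
Proof. rewrite mem_cat; count_boxes. Qed.

(** Without C, [Y] is counted a second time in [K1'] only if [tA] is both unboxed and kept by the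
    first inference, which then has no other principal formula; the bound 2 still holds. The case of
    [X] and [K2'] is symmetric. *)
Lemma allowed_cut_both :
  tA \in U1 -> fA \in U2 -> allowed L (X ++ Y) (K1' ++ K2').
Proof. count_boxes. Qed.

Hypothesis cutA : forall T, der L (tA :: T) -> der L (fA :: T) -> der L T.
Hypothesis d1 : der L (U1 ++ map box K1).
Hypothesis d2 : der L (U2 ++ map box K2).
Hypothesis cut1 : forall T,
  {subset U1 ++ map box K1 <= box tA :: T} ->
  {subset map box (U2 ++ K2) <= box fA :: T} -> der L T.
Hypothesis cut2 : forall T,
  {subset map box (U1 ++ K1) <= box tA :: T} ->
  {subset U2 ++ map box K2 <= box fA :: T} -> der L T.

Let premise1 : der L (U1 ++ map box K1').
Proof.
rewrite /K1'; case: ifPn => h; last first.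
  apply: der_weak d1 => y; rewrite !mem_cat => /orP[->//|].
  case/mapP => z zK ->; rewrite cats0 mem_box mem_drop_all zK andbT.
  by rewrite (memPn h _ zK) orbT.
apply: cut1 => y.
  rewrite inE !mem_cat => /orP[->|]; rewrite ?orbT //.
  case/mapP => z zK ->; case: (eqVneq z tA) => [->|ne]; first by rewrite eqxx.
  by rewrite mem_box mem_cat mem_drop_all ne zK !orbT.
case/mapP => z zK ->; case: (eqVneq z fA) => [->|ne].
  by rewrite inE eqxx.
rewrite inE !mem_cat mem_box !mem_cat !mem_drop_all ne /=.
by move: zK; rewrite mem_cat => /orP[->|->]; rewrite ?orbT.
Qed.

Let premise2 : der L (U2 ++ map box K2').
Proof.
rewrite /K2'; case: ifPn => h; last first.
  apply: der_weak d2 => y; rewrite !mem_cat => /orP[->//|].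
  case/mapP => z zK ->; rewrite cats0 mem_box mem_drop_all zK andbT.
  by rewrite (memPn h _ zK) orbT.
apply: cut2 => y.
  case/mapP => z zK ->; case: (eqVneq z tA) => [->|ne].
    by rewrite inE eqxx.
  rewrite inE !mem_cat mem_box !mem_cat !mem_drop_all ne /=.
  by move: zK; rewrite mem_cat => /orP[->|->]; rewrite ?orbT.
rewrite inE !mem_cat => /orP[->|]; rewrite ?orbT //.
case/mapP => z zK ->; case: (eqVneq z fA) => [->|ne]; first by rewrite eqxx.
by rewrite mem_box mem_cat mem_drop_all ne zK !orbT.
Qed.

Lemma modal_cut T :
  {subset map box (U1 ++ K1) <= box tA :: T} ->
  {subset map box (U2 ++ K2) <= box fA :: T} -> der L T.
Proof.
move=> s1 s2.
have in1 z : z \in U1 ++ K1 -> z != tA -> box z \in T.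
  move=> zU ne; have := s1 (box z); rewrite mem_box inE => /(_ zU) /orP[|//].
  by case: z ne {zU} => b B ne /eqP[e1 e2]; rewrite e1 e2 eqxx in ne.
have in2 z : z \in U2 ++ K2 -> z != fA -> box z \in T.
  move=> zU ne; have := s2 (box z); rewrite mem_box inE => /(_ zU) /orP[|//].
  by case: z ne {zU} => b B ne /eqP[e1 e2]; rewrite e1 e2 eqxx in ne.
have inX z : z \in X ++ drop_all tA K1 -> box z \in T.
  by rewrite mem_cat !mem_drop_all -andb_orr -mem_cat => /andP[? ?]; apply: in1.
have inY z : z \in Y ++ drop_all fA K2 -> box z \in T.
  by rewrite mem_cat !mem_drop_all -andb_orr -mem_cat => /andP[? ?]; apply: in2.
have inK1 z : z \in K1' -> box z \in T.
  rewrite mem_cat => /orP[h|]; first by apply: inX; rewrite mem_cat h orbT.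
  by case: ifP => // _; apply: inY.
have inK2 z : z \in K2' -> box z \in T.
  rewrite mem_cat => /orP[h|]; first by apply: inY; rewrite mem_cat h orbT.
  by case: ifP => // _; apply: inX.
(* If [Box A] is not principal on one side, that inference alone yields [T]. *)
have [t1|t1] := boolP (tA \in U1 ++ K1); last first.
  by apply: (DerModal al1 _ d1) => y /mapP[z zU ->]; apply: in1 (memPn t1 _ zU).
have [t2|t2] := boolP (fA \in U2 ++ K2); last first.
  by apply: (DerModal al2 _ d2) => y /mapP[z zU ->]; apply: in2 (memPn t2 _ zU).
(* If [A] is kept but not unboxed, the same inference is repeated with the cleaned context. *)
have [u1|u1] := boolP (tA \in U1); last first.
  have k1 : tA \in K1 by move: t1; rewrite mem_cat (negbTE u1).
  apply: (DerModal (allowed_cut_left t2 u1 k1) _ premise1) => y /mapP[z].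
  rewrite mem_cat => /orP[zU|/inK1 ? ->//] ->; apply: in1 (memPn u1 _ zU).
  by rewrite mem_cat zU.
have [u2|u2] := boolP (fA \in U2); last first.
  have k2 : fA \in K2 by move: t2; rewrite mem_cat (negbTE u2).
  apply: (DerModal (allowed_cut_right t1 u2 k2) _ premise2) => y /mapP[z].
  rewrite mem_cat => /orP[zU|/inK2 ? ->//] ->; apply: in2 (memPn u2 _ zU).
  by rewrite mem_cat zU.
apply: (DerModal (allowed_cut_both u1 u2)).
  move=> y /mapP[z + ->]; rewrite !mem_cat => /orP[/orP[h|h]|].
  - by apply: inX; rewrite mem_cat h.
  - by apply: inY; rewrite mem_cat h.
  by rewrite -!mem_cat mem_cat => /orP[/inK1|/inK2].
move: premise1 premise2; generalize K1' K2' => J1 J2 p1 p2; apply: cutA.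
  apply: der_weak p1 => y.
  rewrite inE map_cat !mem_cat mem_drop_all => /orP[h|->]; last by rewrite !orbT.
  by case: eqVneq h => //= _ ->.
apply: der_weak p2 => y.
rewrite inE map_cat !mem_cat !mem_drop_all => /orP[h|->]; last by rewrite !orbT.
by case: (eqVneq y fA) h => //= _ ->; rewrite !orbT.
Qed.

End ModalCut.

(** Induction on the first derivation and, inside it, on the second. Between two modal inferences,
    the outer hypothesis cuts the first premise against the whole second inference, and the inner
    one cuts the whole first inference against the second premise. *)
Lemma der_cut_box L A : regular L ->
  (forall T, der L ((true, A) :: T) -> der L ((false, A) :: T) -> der L T) ->
  forall S1, der L S1 -> forall S2, der L S2 -> forall T,
  {subset S1 <= (true, Box A) :: T} -> {subset S2 <= (false, Box A) :: T} ->
  der L T.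
Proof.
move=> reg cutA.
have sub_cat (S T q : seq signed) x : {subset S <= x :: T} ->
    {subset q ++ S <= x :: (q ++ T)}.
  move=> s y; rewrite inE !mem_cat => /orP[->|/s]; rewrite ?orbT //.
  by rewrite inE => /orP[->|->]; rewrite ?orbT.
have sub_catr (S T q : seq signed) x : {subset S <= x :: T} ->
    {subset S <= x :: (q ++ T)}.
  by move=> s y /s; rewrite !inE mem_cat => /orP[->|->]; rewrite ?orbT.
move=> S1 d1; elim: d1 => {S1}.
- move=> S p h1 h2 S2 _ T s1 _; move/s1: h1; move/s1: h2; rewrite !inE.
  by move=> /orP[/eqP//|h2] /orP[/eqP//|h1]; apply: (DerInit _ h1 h2).
- move=> S x ps xS e _ IH S2 d2 T s1 s2.
  move/s1: (xS); rewrite inE => /orP[/eqP h|xT]; first by rewrite h in e.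
  apply: (DerProp xT e) => q qps; apply: (IH _ qps _ d2).
    exact: sub_cat.
  exact: sub_catr.
move=> S U1 K1 al1 sU1 d1 IH1 S2 d2 T s1.
(* Reducing the arbitrary context to the principal formulas gives the inner induction hypothesis the
   form [cut2]. *)
have {}s1 : {subset map box (U1 ++ K1) <= (true, Box A) :: T}.
  by move=> y /sU1 /s1.
elim: d2 T s1 => {S2}.
- move=> S2 p h1 h2 T _ s2; move/s2: h1; move/s2: h2; rewrite !inE.
  by move=> /orP[/eqP//|h2] /orP[/eqP//|h1]; apply: (DerInit _ h1 h2).
- move=> S2 x ps xS e _ IH T s1 s2.
  move/s2: (xS); rewrite inE => /orP[/eqP h|xT]; first by rewrite h in e.
  apply: (DerProp xT e) => q qps; apply: (IH _ qps).
    exact: sub_catr.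
  exact: sub_cat.
move=> S2 U2 K2 al2 sU2 d2 IH2 T s1 s2.
apply: (modal_cut reg al1 al2 cutA d1 d2 _ IH2 s1) => [T' s1' s2'|]; last first.
  by move=> y /sU2 /s2.
apply: (IH1 (map box (U2 ++ K2))) => //; exact: (DerModal al2).
Qed.

(** Induction on the left derivation suffices: a variable is principal only in an initial sequent,
    and there the right derivation closes the case by contraction. *)
Lemma der_cut_var L p S1 : der L S1 -> forall T,
  {subset S1 <= (true, Var p) :: T} -> der L ((false, Var p) :: T) -> der L T.
Proof.
elim=> {S1}.
- move=> S q h1 h2 T s d; move/s: h2; move/s: h1; rewrite !inE.
  case/orP=> [/eqP[e]|h1] /orP[/eqP//|h2]; last exact: DerInit _ h1 h2.
  by rewrite e in h2; apply: der_contr d.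
- move=> S x ps xS e _ IH T s d.
  move/s: (xS); rewrite inE => /orP[/eqP h|xT]; first by rewrite h in e.
  apply: (DerProp xT e) => q qps; apply: (IH _ qps).
    move=> y; rewrite !(inE, mem_cat) => /orP[->|/s]; rewrite ?orbT //.
    by rewrite inE => /orP[->|->]; rewrite ?orbT.
  by apply: der_weak d => y; rewrite !inE mem_cat => /orP[->|->]; rewrite ?orbT.
move=> S U K a sU d _ T s _; apply: (DerModal a _ d) => y yU.
by move/sU/s: (yU); rewrite inE => /orP[/eqP h|//]; case/mapP: yU h => z _ -> [].
Qed.

Theorem der_cut L A : regular L ->
  forall T, der L ((true, A) :: T) -> der L ((false, A) :: T) -> der L T.
Proof.
move=> reg; elim: A => [p|||A IH|A IHA B IHB|A IHA B IHB|A IHA B IHB|A IH] T d1 d2.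
- exact: (der_cut_var d1 _ d2).
- by have := @der_invert _ _ (false, Bot) _ [::] erefl (mem_head _ _) d2.
- by have := @der_invert _ _ (true, Top) _ [::] erefl (mem_head _ _) d1.
- have e1 := @der_invert _ _ (true, Neg A) _ _ erefl (mem_head _ _) d1.
  have e2 := @der_invert _ _ (false, Neg A) _ _ erefl (mem_head _ _) d2.
  exact: IH e2 e1.
- have e1 := @der_invert _ _ (true, And A B) _ _ erefl (mem_head _ _) d1.
  have e2 := @der_invert _ _ (false, And A B) _ _ erefl (mem_head _ _) d2.
  have e3 := @der_invert _ _ (false, And A B) _ _ erefl (mem_last _ _) d2.
  apply: IHB e3; apply: IHA e1 _; apply: der_weak e2 => y.
  by rewrite !inE => /orP[->|->]; rewrite ?orbT.
- have e1 := @der_invert _ _ (false, Or A B) _ _ erefl (mem_head _ _) d2.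
  have e2 := @der_invert _ _ (true, Or A B) _ _ erefl (mem_head _ _) d1.
  have e3 := @der_invert _ _ (true, Or A B) _ _ erefl (mem_last _ _) d1.
  apply: (IHB _ e3); apply: (IHA _ _ e1); apply: der_weak e2 => y.
  by rewrite !inE => /orP[->|->]; rewrite ?orbT.
- have e1 := @der_invert _ _ (false, Imp A B) _ _ erefl (mem_head _ _) d2.
  have e2 := @der_invert _ _ (true, Imp A B) _ _ erefl (mem_head _ _) d1.
  have e3 := @der_invert _ _ (true, Imp A B) _ _ erefl (mem_last _ _) d1.
  apply: (IHB _ e3); apply: (IHA _ e1); apply: der_weak e2 => y.
  by rewrite !inE => /orP[->|->]; rewrite ?orbT.
exact: (der_cut_box reg IH d1 d2 (T := T)).
Qed.

(** * Derivability of theorems *)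

Lemma der_id L A S : (true, A) \in S -> (false, A) \in S -> der L S.
Proof.
elim: A S => [p|||A IH|A IHA B IHB|A IHA B IHB|A IHA B IHB|A IH] S h1 h2.
- exact: DerInit h1 h2.
- exact: (DerProp h1).
- exact: (DerProp h2).
- apply: (DerProp h1 erefl) => q; rewrite inE => /eqP->.
  apply: (DerProp (x := (false, Neg A)) _ erefl); first by rewrite inE h2 orbT.
  by move=> q'; rewrite inE => /eqP->; apply: IH; rewrite !inE eqxx ?orbT.
- apply: (DerProp h1 erefl) => q; rewrite inE => /eqP->.
  apply: (DerProp (x := (false, And A B)) _ erefl); first by rewrite !inE h2 !orbT.
  move=> q'; rewrite !inE => /orP[/eqP->|/eqP->].
    by apply: IHA; rewrite !inE eqxx ?orbT.
  by apply: IHB; rewrite !inE eqxx ?orbT.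
- apply: (DerProp h2 erefl) => q; rewrite inE => /eqP->.
  apply: (DerProp (x := (true, Or A B)) _ erefl); first by rewrite !inE h1 !orbT.
  move=> q'; rewrite !inE => /orP[/eqP->|/eqP->].
    by apply: IHA; rewrite !inE eqxx ?orbT.
  by apply: IHB; rewrite !inE eqxx ?orbT.
- apply: (DerProp h2 erefl) => q; rewrite inE => /eqP->.
  apply: (DerProp (x := (true, Imp A B)) _ erefl); first by rewrite !inE h1 !orbT.
  move=> q'; rewrite !inE => /orP[/eqP->|/eqP->].
    by apply: IHA; rewrite !inE eqxx ?orbT.
  by apply: IHB; rewrite !inE eqxx ?orbT.
apply: (@DerModal _ _ [:: (true, A); (false, A)] [::]).
- by rewrite /allowed /= !orbT.
- by move=> y; rewrite !inE => /orP[/eqP->|/eqP->].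
by apply: IH; rewrite !inE eqxx ?orbT.
Qed.

(** * Derivability of tautologies and of all theorems *)

Fixpoint atoms (A : formula) : seq formula :=
  match A with
  | Var _ | Box _ => [:: A]
  | Bot | Top => [::]
  | Neg A => atoms A
  | And A B | Or A B | Imp A B => atoms A ++ atoms B
  end.

Lemma mem_cat_l (T : eqType) (s t : seq T) x : x \in s -> x \in s ++ t.
Proof. by rewrite mem_cat => ->. Qed.

Lemma mem_cat_r (T : eqType) (s t : seq T) x : x \in t -> x \in s ++ t.
Proof. by rewrite mem_cat orbC => ->. Qed.

Lemma der_insert L x y q S : x \in q -> der L (x :: S) -> der L (q ++ y :: S).
Proof.
move=> xq; apply: der_weak => z; rewrite mem_cat !inE => /orP[/eqP->|->].
  by rewrite xq.
by rewrite !orbT.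
Qed.

(** Kalmar's lemma: with true atoms on the left and false ones on the right, a true formula is
    derivable on the right and a false one is refutable on the left. *)
Lemma der_beval L (f : formula -> bool) A S :
  (forall B, B \in atoms A -> (f B, B) \in S) ->
  der L ((~~ beval (fun p => f (Var p)) (fun B => f (Box B)) A, A) :: S).
Proof.
set e := beval _ _.
elim: A => [p|||A IH|A IHA B IHB|A IHA B IHB|A IHA B IHB|A IH] h.
- have := h (Var p) (mem_head _ _); rewrite /e /=; case: (f _) => h';
    by apply: (@der_id _ (Var p)); rewrite inE ?eqxx ?h' ?orbT.
- exact: (DerProp (ps := [::]) (mem_head _ _)).
- exact: (DerProp (ps := [::]) (mem_head _ _)).
- have := IH h; rewrite (_ : e (Neg A) = ~~ e A) //; case: (e A) => dA;
    (apply: (DerProp (mem_head _ _)); [reflexivity|move=> q]);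
    by rewrite inE => /eqP->; apply: der_insert dA; rewrite inE.
- have dA := IHA (fun C hC => h C (mem_cat_l _ hC)).
  have dB := IHB (fun C hC => h C (mem_cat_r _ hC)).
  move: dA dB; rewrite (_ : e (And A B) = e A && e B) //.
  by case: (e A); case: (e B) => dA dB; (apply: (DerProp (mem_head _ _));
    [reflexivity|move=> q]); rewrite !inE; do ?case/orP; move=> /eqP->;
    solve [apply: der_insert dA; rewrite !inE eqxx ?orbT //
          |apply: der_insert dB; rewrite !inE eqxx ?orbT //].
- have dA := IHA (fun C hC => h C (mem_cat_l _ hC)).
  have dB := IHB (fun C hC => h C (mem_cat_r _ hC)).
  move: dA dB; rewrite (_ : e (Or A B) = e A || e B) //.
  by case: (e A); case: (e B) => dA dB; (apply: (DerProp (mem_head _ _));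
    [reflexivity|move=> q]); rewrite !inE; do ?case/orP; move=> /eqP->;
    solve [apply: der_insert dA; rewrite !inE eqxx ?orbT //
          |apply: der_insert dB; rewrite !inE eqxx ?orbT //].
- have dA := IHA (fun C hC => h C (mem_cat_l _ hC)).
  have dB := IHB (fun C hC => h C (mem_cat_r _ hC)).
  move: dA dB; rewrite (_ : e (Imp A B) = (e A ==> e B)) //.
  by case: (e A); case: (e B) => dA dB; (apply: (DerProp (mem_head _ _));
    [reflexivity|move=> q]); rewrite !inE; do ?case/orP; move=> /eqP->;
    solve [apply: der_insert dA; rewrite !inE eqxx ?orbT //
          |apply: der_insert dB; rewrite !inE eqxx ?orbT //].
have := h (Box A) (mem_head _ _); rewrite /e /=; case: (f _) => h';
  by apply: (@der_id _ (Box A)); rewrite inE ?eqxx ?h' ?orbT.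
Qed.

(** One cut per atom discharges the contexts of Kalmar's lemma. The valuation is altered at [C]
    everywhere, so repeated atoms keep consistent signs. *)
Lemma der_cases L S (Bs : seq formula) : regular L ->
  (forall f, der L ([seq (f B, B) | B <- Bs] ++ S)) -> der L S.
Proof.
move=> reg; elim: Bs => [/(_ xpredT)//|C Bs IH h]; apply: IH => f.
have sub b : {subset [seq ((if B == C then b else f B), B) | B <- C :: Bs] ++ S
    <= (b, C) :: [seq (f B, B) | B <- Bs] ++ S}.
  move=> y; rewrite mem_cat => /orP[/mapP[B + ->]|yS]; last first.
    by rewrite inE mem_cat yS !orbT.
  rewrite inE; case: eqVneq => [-> _|ne /= hB]; first exact: mem_head.
  by rewrite inE mem_cat (map_f (fun B => (f B, B)) hB) orbT.
by apply: (der_cut (A := C)) => //; apply: der_weak (sub _) _; apply: h.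
Qed.

Lemma der_tautology L A : regular L -> tautology A -> der L [:: (false, A)].
Proof.
move=> reg taut; apply: (der_cases (Bs := atoms A) reg) => f.
have := @der_beval L f A [seq (f B, B) | B <- atoms A]; rewrite taut => d.
apply: der_weak (d _) => [y|B]; first by rewrite mem_cat !inE orbC.
exact: (map_f (fun B => (f B, B))).
Qed.

Ltac der_prop x :=
  apply: (@DerProp _ _ x _ _ erefl);
  [by rewrite !inE !eqxx ?orbT
  |move=> ?; rewrite !inE; do ?[case/orP]; move=> /eqP->; rewrite /=].

Lemma logic_der L A : regular L -> logic L A -> der L [:: (false, A)].
Proof.
move=> reg; have := reg; case/and5P => h5 hCN hC4 hD4 hPC.
elim=> {A}.
- by move=> A; apply: der_tautology.
- move=> A B.
  der_prop (false, Imp (Box (And A B)) (And (Box A) (Box B))).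
  der_prop (false, And (Box A) (Box B)).
    apply: (@DerModal _ _ [:: (true, And A B); (false, A)] [::]).
    + by rewrite /allowed /= !orbT.
    + by move=> y; rewrite !inE => /orP[/eqP->|/eqP->]; rewrite !eqxx ?orbT.
    der_prop (true, And A B).
    by apply: (@der_id _ A); rewrite !inE eqxx ?orbT.
  apply: (@DerModal _ _ [:: (true, And A B); (false, B)] [::]).
  + by rewrite /allowed /= !orbT.
  + by move=> y; rewrite !inE => /orP[/eqP->|/eqP->]; rewrite !eqxx ?orbT.
  der_prop (true, And A B).
  by apply: (@der_id _ B); rewrite !inE eqxx ?orbT.
- move=> a A aL inst; case: inst aL => [{}A B|||{}A|{}A|{}A] aL.
  + der_prop (false, Imp (And (Box A) (Box B)) (Box (And A B))).
    der_prop (true, And (Box A) (Box B)).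
    apply: (@DerModal _ _ [:: (true, A); (true, B); (false, And A B)] [::]).
    * by rewrite /allowed aL /= !orbT.
    * by move=> y; rewrite !inE => /or3P[] /eqP->; rewrite !eqxx ?orbT.
    der_prop (false, And A B).
      by apply: (@der_id _ A); rewrite !inE eqxx ?orbT.
    by apply: (@der_id _ B); rewrite !inE eqxx ?orbT.
  + apply: (@DerModal _ _ [:: (false, Top)] [::]).
    * by rewrite /allowed /= !orbT.
    * by move=> y; rewrite !inE => /eqP->.
    exact: (DerProp (ps := [::]) (mem_head _ _)).
  + der_prop (false, Neg (Box Bot)).
    apply: (@DerModal _ _ [:: (true, Bot)] [::]).
    * by rewrite /allowed aL /= !orbT.
    * by move=> y; rewrite !inE => /eqP->.
    exact: (DerProp (ps := [::]) (mem_head _ _)).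
  + der_prop (false, Neg (And (Box A) (Box (Neg A)))).
    der_prop (true, And (Box A) (Box (Neg A))).
    apply: (@DerModal _ _ [:: (true, A); (true, Neg A)] [::]).
    * by rewrite /allowed aL /= !orbT.
    * by move=> y; rewrite !inE => /orP[] /eqP->; rewrite !eqxx ?orbT.
    der_prop (true, Neg A).
    by apply: (@der_id _ A); rewrite !inE eqxx ?orbT.
  + der_prop (false, Imp (Box A) (Box (Box A))).
    apply: (@DerModal _ _ [:: (false, Box A)] [:: (true, A)]).
    * by rewrite /allowed aL /= !orbT.
    * by move=> y; rewrite !inE => /orP[] /eqP->; rewrite !eqxx ?orbT.
    by apply: (@der_id _ (Box A)); rewrite !inE eqxx ?orbT.
  der_prop (false, Or (Box A) (Box (Neg (Box A)))).
  (* Unboxing [Neg (Box A)] while 5 keeps [Box A] on the right leaves an instance of excluded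
     middle. *)
  apply: (@DerModal _ _ [:: (false, Neg (Box A))] [:: (false, A)]).
  * by rewrite /allowed /= !orbT.
  * by move=> y; rewrite !inE => /orP[] /eqP->; rewrite !eqxx ?orbT.
  der_prop (false, Neg (Box A)).
  by apply: (@der_id _ (Box A)); rewrite !inE eqxx ?orbT.
- move=> A B _ dI _ dA.
  have := @der_invert _ _ (false, Imp A B) _ _ erefl (mem_head _ _) dI => /= d.
  apply: (der_cut (A := A) reg d); apply: der_weak dA => y.
  by rewrite !inE => ->.
move=> A B _ dI _ _.
have := @der_invert _ _ (false, Imp A B) _ _ erefl (mem_head _ _) dI => /= d.
der_prop (false, Imp (Box A) (Box B)).
apply: (@DerModal _ _ [:: (true, A); (false, B)] [::] _ _ d).
- by rewrite /allowed /= !orbT.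
by move=> y; rewrite !inE => /orP[] /eqP->; rewrite !eqxx ?orbT.
Qed.

(** * Simulation in linear nested sequents *)

Definition lhs (S : seq signed) : {mset formula} :=
  seq_mset [seq x.2 | x <- S & x.1].

Definition rhs (S : seq signed) : {mset formula} :=
  seq_mset [seq x.2 | x <- S & ~~ x.1].

Definition sequent_of (S : seq signed) : sequent := lhs S ⇒ rhs S.

Lemma seq_mset_cons (T : choiceType) (x : T) s : seq_mset (x :: s) = x +` seq_mset s.
Proof.
apply/msetP=> y; rewrite mset_seqE msetE2 msetnE mset_seqE /= [x == y]eq_sym.
by case: eqP.
Qed.

Lemma seq_mset_nil (T : choiceType) : seq_mset (@nil T) = mset0.
Proof. by apply/msetP=> y; rewrite mset_seqE mset0E. Qed.

Lemma lhs_left A S : lhs ((true, A) :: S) = A +` lhs S.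
Proof. exact: seq_mset_cons. Qed.

Lemma lhs_right A S : lhs ((false, A) :: S) = lhs S.
Proof. by []. Qed.

Lemma rhs_left A S : rhs ((true, A) :: S) = rhs S.
Proof. by []. Qed.

Lemma rhs_right A S : rhs ((false, A) :: S) = A +` rhs S.
Proof. exact: seq_mset_cons. Qed.

Lemma lhs_nil : lhs [::] = mset0.
Proof. exact: seq_mset_nil. Qed.

Lemma rhs_nil : rhs [::] = mset0.
Proof. exact: seq_mset_nil. Qed.

Definition lhs_rhs_cons := (lhs_left, lhs_right, rhs_left, rhs_right).

Lemma sequent_of_perm S T : perm_eq S T -> sequent_of S = sequent_of T.
Proof.
by move=> pST; congr Seq; apply/eq_seq_msetP; apply: perm_map; apply: perm_filter.
Qed.

Definition prov (L : {set axiom_name}) : lns -> Prop :=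
  derivable (with_struct (LNS L)).

Lemma prov_rule1 L X Y : with_struct (LNS L) [:: X] Y -> prov L X -> prov L Y.
Proof. by move=> r d; apply: (Derive r) => Z [<-|]. Qed.

(** Every rule admits a longer prefix, so a premise derived on its own can serve as the last
    component after [s]. *)
Lemma prov_next L s X : prov L X -> prov L (Next s X).
Proof.
elim=> {X} Xs Y r _ IH; apply: (@Derive _ (map (Next s) Xs)); last first.
  by move=> Z /List.in_map_iff[X [<- /IH]].
case: r => {Xs Y IH} [Xs Y r|C p c sr]; last exact: (@WSStruct _ (CtxNext s C)).
apply: WSBase; case: r => {Xs Y}.
- move=> C ps c bC r; rewrite -map_comp.
  exact: (@LNSProp L (CtxNext s C)).
- by move=> H B G D; exact: (@LNSBoxR L (s :: H)).
- by move=> H A G D G' D'; exact: (@LNSBoxL L (s :: H)).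
move=> a X Y aL r; apply: (LNSAx aL); case: r => {a aL X Y}.
- by move=> H t G D; apply: (RC (s :: H)).
- by move=> H t G D; apply: (RN (s :: H)).
- by move=> H G D; apply: (RP (s :: H)).
- by move=> H A G D; apply: (RD (s :: H)).
- by move=> H A G D G' D'; apply: (R4 (s :: H)).
by move=> H A G D G' D'; apply: (R5 (s :: H)).
Qed.

Section Structural.

Variables (L : {set axiom_name}) (C : context).

Lemma prov_weak1 x S :
  prov L (fill C (sequent_of S)) -> prov L (fill C (sequent_of (x :: S))).
Proof.
case: x => -[] A; apply: prov_rule1; apply: WSStruct.
  by rewrite /sequent_of !lhs_rhs_cons; apply: RWeakL.
by rewrite /sequent_of !lhs_rhs_cons; apply: RWeakR.
Qed.

Lemma prov_contr1 x S : x \in S ->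
  prov L (fill C (sequent_of (x :: S))) -> prov L (fill C (sequent_of S)).
Proof.
move=> xS; have pS : perm_eq S (x :: rem x S) by exact: perm_to_rem.
rewrite (sequent_of_perm pS).
rewrite (@sequent_of_perm (x :: S) (x :: x :: rem x S)) ?perm_cons //.
case: x {xS pS} => -[] A; apply: prov_rule1; apply: WSStruct; move: (rem _ _) => T.
  rewrite /sequent_of !lhs_rhs_cons; exact: RContrL.
rewrite /sequent_of !lhs_rhs_cons; exact: RContrR.
Qed.

(** Weaken to [S ++ T], then contract each formula of [S] with its copy in [T]: provability ignores
    multiplicities, as [der] does. *)
Lemma prov_sub S T : {subset S <= T} ->
  prov L (fill C (sequent_of S)) -> prov L (fill C (sequent_of T)).
Proof.
move=> sST d; have : prov L (fill C (sequent_of (S ++ T))).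
  rewrite (sequent_of_perm (permEl (perm_catC S T))).
  by elim: {sST} T => [|x T IH]; [exact: d|rewrite cat_cons; apply: prov_weak1].
elim: S {d} sST => [//|x S IH sST d]; apply: IH => [y yS|].
  by apply: sST; rewrite inE yS orbT.
by apply: prov_contr1 d; rewrite mem_cat sST ?mem_head ?orbT.
Qed.

End Structural.

(** * Simulation of one modal inference *)

Definition is_box (A : formula) : bool := if A is Box _ then true else false.

(* The formulas which the rules Box_L, 4 and 5 can move from the last component
   to boxed formulas of the component [S]. *)
Definition movable (L : {set axiom_name}) (S : seq signed) (y : signed) : bool :=
  y.1 && (box y \in S)
  || [&& y \in S, is_box y.2, Ax5 \in L & y.1 ==> (Ax4 \in L)].

(** Read upwards, the boxed formula is contracted before it is consumed, so the whole of [S] remains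
    available for further moves. *)
Lemma prov_move L S R y : movable L S y ->
  prov L (Next (sequent_of S) (Single (sequent_of (y :: R)))) ->
  prov L (Trans (sequent_of S) (sequent_of R)).
Proof.
case: y => b A /orP[/andP[/= -> yS]|/and4P[yS boxA h5 h4]] d.
- apply: (@prov_contr1 L (HoleTrans (sequent_of R)) _ _ yS) => /=.
  move: d; rewrite /sequent_of !lhs_rhs_cons; apply: prov_rule1; apply: WSBase.
  exact: (@LNSBoxL L [::]).
apply: (@prov_contr1 L (HoleTrans (sequent_of R)) _ _ yS) => /=.
move: boxA h4 d {yS}; case: A => //= A _; case: b => [h4|_].
  rewrite /sequent_of !lhs_rhs_cons; apply: prov_rule1; apply: WSBase; apply: (LNSAx h4).
  exact: (R4 [::]).
rewrite /sequent_of !lhs_rhs_cons; apply: prov_rule1; apply: WSBase; apply: (LNSAx h5).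
exact: (R5 [::]).
Qed.

Lemma prov_open (L : {set axiom_name}) (S : seq signed) (z : signed) :
  ~~ z.1 || (AxD \in L) -> box z \in S ->
  prov L (Trans (sequent_of S) (sequent_of [:: z])) ->
  prov L (Single (sequent_of S)).
Proof.
move=> hz zS d; apply: (@prov_contr1 L HoleEnd _ _ zS) => /=.
move: hz d {zS}; case: z => -[] A /= hz.
  rewrite /sequent_of !lhs_rhs_cons lhs_nil rhs_nil msetD0.
  apply: prov_rule1; apply: WSBase; apply: (LNSAx hz); exact: (RD [::]).
rewrite /sequent_of !lhs_rhs_cons lhs_nil rhs_nil msetD0 => d.
apply: (prov_rule1 _ d); apply: WSBase; exact: (@LNSBoxR L [::]).
Qed.

(** Read upwards, C restores [/_m] after each move, so that another formula can follow, and N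
    finally turns [/_m] into [/]. *)
Lemma prov_move_all (L : {set axiom_name}) (S Q : seq signed) z :
  regular L -> AxC \in L -> all (movable L S) Q ->
  prov L (Next (sequent_of S) (Single (sequent_of (Q ++ [:: z])))) ->
  prov L (Trans (sequent_of S) (sequent_of [:: z])).
Proof.
move=> /and5P[_ /eqP hCN _ _ _] hC; elim: Q => [_|y Q IH] /=.
  apply: prov_rule1; apply: WSBase; apply: (@LNSAx L AxN); first by rewrite -hCN.
  exact: (RN [::]).
case/andP=> my mQ d; apply: IH mQ _; move: (prov_move my d).
apply: prov_rule1; apply: WSBase; apply: (LNSAx hC); exact: (RC [::]).
Qed.

Lemma prov_modal_at (L : {set axiom_name}) (S Q : seq signed) (z : signed) :
  regular L -> all (movable L S) Q ->
  (AxC \in L) || (size Q <= 1) -> ~~ z.1 || (AxD \in L) -> box z \in S ->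
  prov L (Single (sequent_of (Q ++ [:: z]))) -> prov L (Single (sequent_of S)).
Proof.
move=> reg mQ; have /and5P[h5 _ _ _ _] := reg.
have [hC _|hC /= sQ] := boolP (AxC \in L) => hz zS d.
  by apply: (prov_open hz zS); apply: prov_move_all mQ _ => //; apply: prov_next.
have {mQ d} [y my d] : exists2 y, movable L S y &
    prov L (Single (sequent_of [:: y; z])).
  case: Q mQ sQ d => [|y [|//]] /= mQ _ d; last by exists y => //; case/andP: mQ.
  (* Here nothing is left to move, yet a move has to release the component. The opening formula
     serves again: Box_L moves [A] if it is on the left, 5 moves [Box A] if it is on the right; the
     surplus formula comes from weakening. *)
  case: z hz zS d => -[] A /= hz zS d.
    exists (true, A); first by rewrite /movable zS.
    exact: (@prov_weak1 L HoleEnd).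
  exists (false, Box A); last exact: (@prov_weak1 L HoleEnd).
  by rewrite /movable zS h5 orbT.
by apply: (prov_open hz zS); apply: (prov_move my); apply: prov_next.
Qed.

(** The component is opened by the unboxed right formula if there is one, otherwise by a left one
    through D, otherwise empty through P. *)
Lemma prov_modal L S U K : regular L -> allowed L U K ->
  {subset map box (U ++ K) <= S} ->
  prov L (Single (sequent_of (U ++ map box K))) -> prov L (Single (sequent_of S)).
Proof.
move=> reg /and4P[hsize hneg hopen h4] sS d; have /and5P[h5 _ _ _ hPC] := reg.
have sizeE (T : seq signed) : size T = pos T + neg T by rewrite count_predC.
have moveK : all (movable L S) (map box K).
  apply/allP => _ /mapP[k kK ->].
  have kS : box k \in S by apply: sS; rewrite mem_box mem_cat kK orbT.
  rewrite /movable kS h5 /=; case: (boolP k.1) => //= kpos.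
  case/orP: h4 => [->|]; first by rewrite orbT.
  by rewrite -leqn0 leqNgt -has_count => /hasPn /(_ _ kK); rewrite kpos.
have moveU T : {subset T <= U} -> neg T = 0 -> all (movable L S) T.
  move=> sT nT; apply/allP => u uT.
  have : u.1.
    have := nT; move/eqP; rewrite -leqn0 leqNgt -has_count => /hasPn /(_ _ uT).
    by rewrite negbK.
  by move=> up; rewrite /movable up sS // mem_box mem_cat sT.
have open_at z : z \in U -> neg (rem z U) = 0 -> ~~ z.1 || (AxD \in L) ->
    prov L (Single (sequent_of S)).
  move=> zU nz hz; apply: (@prov_modal_at L S (rem z U ++ map box K) z reg _ _ hz).
  - by rewrite all_cat moveK andbT; apply: moveU nz => y; apply: mem_rem.
  - rewrite size_cat size_map size_rem // !sizeE.
    have : 0 < pos U + neg U by rewrite -sizeE; case: (U) zU.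
    case/orP: hsize => [->//|]; rewrite orbC; case: (pos U + neg U) => //= n.
    by rewrite addSn ltnS => ->.
  - by apply: sS; rewrite mem_box mem_cat zU.
  apply: (@prov_sub L HoleEnd) d => y; rewrite !mem_cat => /orP[yU|->].
    rewrite inE; case: (eqVneq y z) => [|ne]; first by rewrite orbT.
    by rewrite (perm_mem (perm_to_rem zU)) inE (negbTE ne) /= in yU; rewrite yU.
  by rewrite orbT.
have [n1|n1] := eqVneq (neg U) 1.
  have : has (fun x => ~~ x.1) U by rewrite has_count -/(neg U) n1.
  case/hasP => z zU zneg; apply: (open_at z zU); last by rewrite zneg.
  have := n1; rewrite /neg (seq.permP (perm_to_rem zU)) /= zneg.
  by move: (count _ _) => k; lia.
have n0 : neg U = 0 by case: (neg U) hneg n1 => [|[]].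
case: (posnP (size U)) => [/size0nil U0|sU].
  rewrite U0 /= in d; apply: (@prov_sub L HoleEnd) d => y yK; apply: sS.
  by rewrite map_cat mem_cat yK orbT.
have [u [V EU]] : exists u V, U = u :: V.
  by case: (U) sU => // u V _; exists u, V.
subst U.
have up : u.1 by move: n0; rewrite /neg /=; case: (u.1).
have [hD|hD] := boolP (AxD \in L).
  apply: (open_at u (mem_head _ _)); last by rewrite hD orbT.
  by rewrite /= eqxx; move: n0; rewrite /neg /= up.
move: hopen; rewrite (negbTE hD) (negbTE n1) -!sizeE => /andP[hP].
rewrite addSn ltnS leqn0 addn_eq0 => /andP[/eqP/size0nil V0 /eqP/size0nil K0].
move: d; rewrite V0 K0 => d; have uS : box u \in S by apply: sS; rewrite mem_head.
have mu : movable L S u by rewrite /movable up uS.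
have := prov_move mu (prov_next _ d).
rewrite {2}/sequent_of lhs_nil rhs_nil; apply: prov_rule1; apply: WSBase.
apply: (LNSAx hP); exact: (RP [::]).
Qed.

(* [Bot] on the right and [Top] on the left have no rule of their own: they are
   dropped by weakening. *)
Lemma decompose_rule (S : seq signed) (x : signed) (ps : seq (seq signed)) :
  decompose x = Some ps ->
  ps = [:: [::]] \/
  prop_rule [seq sequent_of (q ++ S) | q <- ps] (sequent_of (x :: S)).
Proof.
case: x => -[] [p|||A|A B|A B|A B|A]; rewrite [decompose _]/=; try discriminate;
  case=> <-; rewrite [map _ _]/= /sequent_of ?lhs_rhs_cons.
- by right; apply: RBotL.
- by left.
- by right; apply: RNegL.
- by right; apply: RAndL.
- by right; apply: ROrL.
- by right; apply: RImpL.
- by left.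
- by right; apply: RTopR.
- by right; apply: RNegR.
- by right; apply: RAndR.
- by right; apply: ROrR.
by right; apply: RImpR.
Qed.

Lemma der_prov L S : regular L -> der L S -> prov L (Single (sequent_of S)).
Proof.
move=> reg; elim=> {S}.
- move=> S p h1 h2; apply: (@prov_contr1 L HoleEnd _ _ h1).
  apply: (@prov_contr1 L HoleEnd (false, Var p)); first by rewrite inE h2 orbT.
  rewrite /sequent_of !lhs_rhs_cons.
  apply: (@Derive _ [::]) => //; apply: WSBase.
  exact: (@LNSProp L HoleEnd [::] _ isT (RInit _ _ _)).
- move=> S x ps xS e _ IH.
  have [/= triv|rule] := decompose_rule S e.
    by apply: (IH [::]); rewrite triv mem_head.
  apply: (@prov_contr1 L HoleEnd _ _ xS) => /=.
  apply: (@Derive _ [seq Single (sequent_of (q ++ S)) | q <- ps]); last first.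
    move=> X /List.in_map_iff[q [<- qps]]; apply: IH.
    by elim: (ps) qps => //= r rs IHr [->|/IHr]; rewrite inE ?eqxx // => ->; rewrite orbT.
  apply: WSBase; rewrite (map_comp (fill HoleEnd) (fun q => sequent_of (q ++ S))).
  exact: LNSProp.
move=> S U K a s _ d; exact: (prov_modal reg a s d).
Qed.

(** * Soundness *)

Lemma beval_impP v w A B :
  reflect (beval v w A -> beval v w B) (beval v w (Imp A B)).
Proof. exact: implyP. Qed.

Section Hilbert.

Variable L : {set axiom_name}.

Lemma logic_cons (As : seq formula) (B : formula) :
  (forall A, A \in As -> logic L A) ->
  (forall v w, all (beval v w) As -> beval v w B) -> logic L B.
Proof.
elim: As B => [|A As IH] B hAs hB; first by apply: LogTaut => v w; exact: hB.
apply: (@LogMP L A); last by apply: hAs; rewrite mem_head.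
apply: IH => [C hC|v w hw]; first by apply: hAs; rewrite inE hC orbT.
by apply/beval_impP => hA; apply: hB; rewrite /= hA.
Qed.

Lemma logic_cons1 A B : logic L A ->
  (forall v w, beval v w A -> beval v w B) -> logic L B.
Proof.
move=> hA hB; apply: (logic_cons (As := [:: A])) => [C|v w /andP[/hB]//].
by rewrite inE => /eqP->.
Qed.

Lemma logic_cons2 A B C : logic L A -> logic L B ->
  (forall v w, beval v w A -> beval v w B -> beval v w C) -> logic L C.
Proof.
move=> hA hB hC; apply: (logic_cons (As := [:: A; B])) => [D|v w].
  by rewrite !inE => /orP[/eqP->|/eqP->].
by case/and3P=> hvA hvB _; apply: hC.
Qed.

(** If [A] implies [B], then [A] is equivalent to [And A B]; congruence and the axiom M do the
    rest. *)
Lemma logic_RM A B : logic L (Imp A B) -> logic L (Imp (Box A) (Box B)).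
Proof.
move=> h; have h1 : logic L (Imp A (And A B)).
  by apply: (logic_cons1 h) => v w /=; do 2 case: beval.
have h2 : logic L (Imp (And A B) A).
  by apply: LogTaut => v w /=; do 2 case: beval.
apply: (logic_cons2 (LogCong h1 h2) (LogM L A B)) => v w /=.
by case: (w A); case: (w (And A B)); case: (w B).
Qed.

Lemma logic_RM_taut A B : (forall v w, beval v w A -> beval v w B) ->
  logic L (Imp (Box A) (Box B)).
Proof. by move=> h; apply: logic_RM; apply: LogTaut => v w; apply/beval_impP/h. Qed.

Hypothesis hC : AxC \in L.

Lemma logic_K A B : logic L (Imp (Box (Imp A B)) (Imp (Box A) (Box B))).
Proof.
have h : logic L (Imp (Box (And (Imp A B) A)) (Box B)).
  by apply: logic_RM_taut => v w /=; do 2 case: beval.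
apply: (logic_cons2 (LogAx hC (InstC (Imp A B) A)) h) => v w /=.
by case: (w (Imp A B)); case: (w A); case: (w (And _ _)); case: (w B).
Qed.

End Hilbert.

(** * Sequents as formulas, and soundness of single rules *)

Fixpoint conj_of (s : seq formula) : formula :=
  if s is A :: s then And A (conj_of s) else Top.

Fixpoint disj_of (s : seq formula) : formula :=
  if s is A :: s then Or A (disj_of s) else Bot.

Definition formula_of (s : sequent) : formula :=
  let: G ⇒ D := s in Imp (conj_of (enum_mset G)) (disj_of (enum_mset D)).

Lemma beval_conj v w s : beval v w (conj_of s) = all (beval v w) s.
Proof. by elim: s => //= A s ->. Qed.

Lemma beval_disj v w s : beval v w (disj_of s) = has (beval v w) s.
Proof. by elim: s => //= A s ->. Qed.

Lemma all_msetD1 (p : pred formula) A (G : {mset formula}) :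
  all p (A +` G) = p A && all p G.
Proof. by apply: (@eq_all_r _ _ (A :: G)) => x; rewrite inE in_mset1D. Qed.

Lemma has_msetD1 (p : pred formula) A (G : {mset formula}) :
  has p (A +` G) = p A || has p G.
Proof. by apply: (@eq_has_r _ _ (A :: G)) => x; rewrite inE in_mset1D. Qed.

Lemma all_mset0 (p : pred formula) : all p (mset0 : {mset formula}).
Proof. by apply/allP => x; rewrite in_mset0. Qed.

Lemma has_mset0 (p : pred formula) : has p (mset0 : {mset formula}) = false.
Proof. by apply/hasP => -[x]; rewrite in_mset0. Qed.

Lemma all_mset1 (p : pred formula) A : all p [mset A] = p A.
Proof. by rewrite -[[mset A]]msetD0 all_msetD1 all_mset0 andbT. Qed.

Lemma has_mset1 (p : pred formula) A : has p [mset A] = p A.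
Proof. by rewrite -[[mset A]]msetD0 has_msetD1 has_mset0 orbF. Qed.

Lemma beval_formula_of v w (G D : {mset formula}) :
  beval v w (formula_of (G ⇒ D)) = (all (beval v w) G ==> has (beval v w) D).
Proof. by rewrite /= beval_conj beval_disj. Qed.

(** Being pointwise in the valuation, and not mere preservation of validity, it survives an added
    disjunct and becomes a provable implication under boxes. *)
Definition entails (ps : seq sequent) (c : sequent) : Prop :=
  forall v w, all (beval v w) (map formula_of ps) -> beval v w (formula_of c).

Lemma all_formula_of_nil v w : all (beval v w) (map formula_of [::]) = true.
Proof. by []. Qed.

Lemma all_formula_of_cons v w s ps : all (beval v w) (map formula_of (s :: ps)) =
  beval v w (formula_of s) && all (beval v w) (map formula_of ps).
Proof. by []. Qed.

Ltac case_bevals :=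
  repeat match goal with
  | |- context [beval ?v ?w ?A] => is_var A; case: (beval v w A)
  | |- context [@all formula ?p ?s] => case: (@all formula p s)
  | |- context [@has formula ?p ?s] => case: (@has formula p s)
  | |- context [?v ?p] => is_var v; case: (v p : bool)
  end.

Ltac case_quantifiers :=
  rewrite ?all_formula_of_cons ?all_formula_of_nil !beval_formula_of;
  rewrite !(all_msetD1, has_msetD1) /=; case_bevals.

Lemma prop_rule_sound ps c : prop_rule ps c -> entails ps c.
Proof.
by case=> {ps c} [p|||A|A|A B|A B|A B|A B|A B|A B] G D v w; case_quantifiers.
Qed.

Lemma struct_rule_sound p c : struct_rule p c -> entails [:: p] c.
Proof. by case=> {p c} A G D v w; case_quantifiers. Qed.

(* [Box_L], [4] and [5] all have the shape  s / t'  to  s' /_m t, where moving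
   the formula [X] out of the last component turns [t'] into [t]. *)
Definition moves (L : {set axiom_name}) (s t' s' t : sequent) : Prop :=
  exists X,
    [/\ forall v w, beval v w (formula_of t') -> beval v w X ->
          beval v w (formula_of t),
        logic L (Or (formula_of s') (Box X)) &
        entails [:: s] s'].

Lemma beval_or_box v w s A :
  beval v w (Or (formula_of s) (Box A)) = beval v w (formula_of s) || w A.
Proof. by []. Qed.

Ltac case_box_quantifiers :=
  rewrite ?all_formula_of_cons ?all_formula_of_nil ?beval_or_box;
  rewrite ?beval_formula_of !(all_msetD1, has_msetD1) /=; case_bevals.

Lemma moves_boxL (L : {set axiom_name}) A (G D G' D' : {mset formula}) :
  moves L (G ⇒ D) (A +` G' ⇒ D') (Box A +` G ⇒ D) (G' ⇒ D').
Proof.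
exists A; split=> [v w||v w]; try by case_box_quantifiers.
by apply: LogTaut => v w; case_box_quantifiers.
Qed.

Lemma moves_4 (L : {set axiom_name}) A (G D G' D' : {mset formula}) : Ax4 \in L ->
  moves L (G ⇒ D) (Box A +` G' ⇒ D') (Box A +` G ⇒ D) (G' ⇒ D').
Proof.
move=> h4; exists (Box A); split=> [v w||v w]; try by case_box_quantifiers.
by apply: (logic_cons1 (LogAx h4 (Inst4 A))) => v w; case_box_quantifiers.
Qed.

Lemma moves_5 (L : {set axiom_name}) A (G D G' D' : {mset formula}) : Ax5 \in L ->
  moves L (G ⇒ D) (G' ⇒ Box A +` D') (G ⇒ Box A +` D) (G' ⇒ D').
Proof.
(* [Box A] leaves the right side, so the formula assumed is its negation, and axiom 5 provides the
   required disjunction. *)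
move=> h5; exists (Neg (Box A)); split=> [v w||v w]; try by case_box_quantifiers.
by apply: (logic_cons1 (LogAx h5 (Inst5 A))) => v w; case_box_quantifiers.
Qed.

(** The common shape of Box_R, P and D. It is a provable implication, so that it can also be applied
    below the boxes of a prefix. *)
Definition opens (L : {set axiom_name}) (s t s' : sequent) : Prop :=
  logic L (Imp (Or (formula_of s) (Box (formula_of t))) (formula_of s')).

Lemma opens_cons L X s t s' : logic L (Imp (Box (formula_of t)) X) ->
  (forall v w, beval v w (formula_of s) || beval v w X ->
     beval v w (formula_of s')) ->
  opens L s t s'.
Proof.
move=> hX hs; apply: (logic_cons1 hX) => v w /beval_impP h.
apply/beval_impP => /orP hst; apply: hs; apply/orP.
by case: hst => [|/h]; [left|right].
Qed.

Lemma opens_boxR (L : {set axiom_name}) B (G D : {mset formula}) :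
  opens L (G ⇒ D) (mset0 ⇒ [mset B]) (G ⇒ Box B +` D).
Proof.
apply: (@opens_cons L (Box B)) => [|v w]; last by case_box_quantifiers.
apply: logic_RM_taut => v w.
by rewrite beval_formula_of all_mset0 has_mset1.
Qed.

Lemma opens_P (L : {set axiom_name}) (G D : {mset formula}) : AxP \in L ->
  opens L (G ⇒ D) (mset0 ⇒ mset0) (G ⇒ D).
Proof.
move=> hP; apply: (@opens_cons L Bot) => [|v w]; last by rewrite orbF.
have h : logic L (Imp (Box (formula_of (mset0 ⇒ mset0))) (Box Bot)).
  by apply: logic_RM_taut => v w; rewrite beval_formula_of all_mset0 has_mset0.
apply: (logic_cons2 h (LogAx hP InstP)) => v w; rewrite [formula_of]lock /=.
by case: (w _); case: (w _).
Qed.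

Lemma opens_D (L : {set axiom_name}) A (G D : {mset formula}) : AxD \in L ->
  opens L (G ⇒ D) ([mset A] ⇒ mset0) (Box A +` G ⇒ D).
Proof.
move=> hD; apply: (@opens_cons L (Neg (Box A))) => [|v w].
  have h : logic L (Imp (Box (formula_of ([mset A] ⇒ mset0))) (Box (Neg A))).
    apply: logic_RM_taut => v w; rewrite beval_formula_of all_mset1 has_mset0.
    by rewrite implybF.
  apply: (logic_cons2 h (LogAx hD (InstD A))) => v w; rewrite [formula_of]lock /=.
  by case: (w _); case: (w _); case: (w _).
by case_box_quantifiers.
Qed.

(* Without C, a derivable structure has a valid component; the last two
   components are taken together around /_m. *)
Fixpoint some_valid (L : {set axiom_name}) (X : lns) : Prop :=
  match X with
  | Single s => logic L (formula_of s)
  | Trans s t => logic L (Or (formula_of s) (Box (formula_of t)))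
  | Next s X => logic L (formula_of s) \/ some_valid L X
  end.

Lemma some_valid_prefix L H X Y : (some_valid L X -> some_valid L Y) ->
  some_valid L (H // X) -> some_valid L (H // Y).
Proof. by move=> h; elim: H => //= s H IH [hs|/IH hX]; [left|right]. Qed.

(** Validity of [s] passes to [s']. If instead [t'] is valid, then [X] implies [t] outright, and
    monotonicity replaces [Box X] by [Box t]. *)
Lemma moves_some_valid L s t' s' t : moves L s t' s' t ->
  some_valid L (Next s (Single t')) -> some_valid L (Trans s' t).
Proof.
case=> X [ht hs' hss'] [hs|ht']; rewrite /some_valid.
  apply: (logic_cons1 hs) => v w vs; rewrite beval_or_box (hss' v w) //.
  by rewrite all_formula_of_cons vs.
have h : logic L (Imp X (formula_of t)).
  by apply: (logic_cons1 ht') => v w /ht h; exact/beval_impP.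
apply: (logic_cons2 (logic_RM h) hs') => v w.
by rewrite !beval_or_box => /beval_impP hw /orP[->//|/hw ?]; apply/orP; right.
Qed.

(** Separates two cases: some premiss is justified by the components that the rule leaves alone, or
    all are justified by the active one. *)
Lemma In_or (T : Type) (P : Prop) (Q : T -> Prop) (s : seq T) :
  (forall x, List.In x s -> P \/ Q x) -> P \/ forall x, List.In x s -> Q x.
Proof.
elim: s => [_|x s IH h]; first by right.
have [|hP|hs] := IH _; first by move=> y ys; apply: h; right.
  by left.
by have [hP|hx] := h x (or_introl erefl); [left|right=> y [<-|/hs]].
Qed.

Lemma logic_entails L ps c (f : formula -> formula) :
  (forall p, List.In p ps -> logic L (f (formula_of p))) ->
  (forall v w, all (beval v w) (map (f \o formula_of) ps) ->
     beval v w (f (formula_of c))) ->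
  logic L (f (formula_of c)).
Proof.
move=> hps hc; apply: (logic_cons (As := map (f \o formula_of) ps)) => // A.
elim: ps hps {hc} => [//|p ps IH] hps; rewrite inE => /orP[/eqP->|].
  by apply: hps; left.
by apply: IH => q qps; apply: hps; right.
Qed.

(** After [/_m] a rule acts under a box, where monotonicity handles exactly one premiss; hence the
    restriction on blocked holes. *)
Lemma some_valid_fill L C ps c : entails ps c ->
  ~~ blocked C \/ (exists p, ps = [:: p]) ->
  (forall p, List.In p ps -> some_valid L (fill C p)) -> some_valid L (fill C c).
Proof.
move=> e; elim: C => /= [|t|X|t|s C IH] hC h.
- by apply: (logic_entails (f := id) h).
- apply: (logic_entails (f := fun A => Or A (Box (formula_of t))) h) => v w hps.
  rewrite beval_or_box; case: (boolP (w _)) => [|hw]; first by rewrite orbT.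
  rewrite orbF; apply: e; move: hps; rewrite !all_map; apply: sub_all => p.
  by rewrite /= (negbTE hw) orbF.
- have [hX|hps] := In_or (fun p pps => proj1 (or_comm _ _) (h p pps)).
    by right.
  by left; apply: (logic_entails (f := id) hps).
- case: hC => [//|[p eps]]; move: e h; rewrite {}eps => e h.
  have hp := h p (or_introl erefl).
  have hm : logic L (Imp (Box (formula_of p)) (Box (formula_of c))).
    by apply: logic_RM_taut => v w vp; apply: e; rewrite all_formula_of_cons vp.
  apply: (logic_cons2 hp hm) => v w.
  by rewrite !beval_or_box => /orP[->//|hw] /beval_impP/(_ hw) ?; apply/orP; right.
have [hs|hps] := In_or h; first by left.
by right; apply: IH.
Qed.

Lemma some_valid_sound (L : {set axiom_name}) X : AxC \notin L -> AxN \notin L ->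
  derivable (with_struct (LNS L)) X -> some_valid L X.
Proof.
move=> hC hN; elim=> {X} Xs Y r _.
case: r => {Xs Y} [Xs Y r|C p c sr] h; last first.
  apply: (some_valid_fill (struct_rule_sound sr)); first by right; exists p.
  by move=> q [<-|//]; apply: h; left.
case: r h => {Xs Y} [C ps c bC r|H B G D|H A G D G' D'|a X Y aL r] h.
- apply: (some_valid_fill (prop_rule_sound r)); first by left.
  by move=> p pps; apply: h; apply: List.in_map.
- have := h _ (or_introl erefl); apply: some_valid_prefix.
  exact: LogMP (opens_boxR L B G D).
- have := h _ (or_introl erefl); apply: some_valid_prefix.
  exact: moves_some_valid (moves_boxL L A G D G' D').
have {h} := h _ (or_introl erefl).
case: r aL => [H s G D|H s G D|H G D|H A G D|H A G D G' D'|H A G D G' D'] aL.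
- by rewrite aL in hC.
- by rewrite aL in hN.
- by apply: some_valid_prefix; apply: LogMP (opens_P G D aL).
- by apply: some_valid_prefix; apply: LogMP (opens_D A G D aL).
- by apply: some_valid_prefix; apply: moves_some_valid (moves_4 A G D G' D' aL).
by apply: some_valid_prefix; apply: moves_some_valid (moves_5 A G D G' D' aL).
Qed.

(* With C and N the logic is normal, and a structure is read as a formula with
   nested boxes; / and /_m are not distinguished. *)
Fixpoint interp (X : lns) : formula :=
  match X with
  | Single s => formula_of s
  | Trans s t => Or (formula_of s) (Box (formula_of t))
  | Next s X => Or (formula_of s) (Box (interp X))
  end.

Section NormalSoundness.

Variable L : {set axiom_name}.
Hypotheses (hN : AxN \in L) (hC : AxC \in L).

Lemma logic_or_box A X Y : logic L (Imp X Y) ->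
  logic L (Imp (Or A (Box X)) (Or A (Box Y))).
Proof.
move=> /logic_RM h; apply: (logic_cons1 h) => v w /=.
by case: (beval v w A) => //=; rewrite implybT.
Qed.

Lemma interp_prefix H X Y : logic L (Imp (interp X) (interp Y)) ->
  logic L (Imp (interp (H // X)) (interp (H // Y))).
Proof. by move=> h; elim: H => //= s H; apply: logic_or_box. Qed.

(** C joins the boxes of several premisses; N covers the empty list, that is, zero-premiss rules
    inside a box. *)
Lemma logic_box_conj (As : seq formula) :
  logic L (Imp (conj_of (map Box As)) (Box (conj_of As))).
Proof.
elim: As => [|A As IH] /=.
  by apply: (logic_cons1 (LogAx hN InstN)) => v w /= ->.
apply: (logic_cons2 IH (LogAx hC (InstC A (conj_of As)))) => v w.
rewrite [conj_of]lock /=.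
by case: (w A); case: (beval _ _ _) => //= ->.
Qed.

Lemma logic_or_box_conj A (Xs : seq formula) Y : logic L (Imp (conj_of Xs) Y) ->
  logic L (Imp (conj_of [seq Or A (Box X) | X <- Xs]) (Or A (Box Y))).
Proof.
move=> /logic_RM h; apply: (logic_cons2 h (logic_box_conj Xs)) => v w.
move=> /beval_impP h1 /beval_impP h2; apply/beval_impP; rewrite beval_conj => hall.
apply/orP; case: (boolP (beval v w A)) => [|nA]; [by left|right].
apply: h1; apply: h2; rewrite beval_conj; move: hall; rewrite !all_map.
by apply: sub_all => X /=; rewrite (negbTE nA).
Qed.

Lemma interp_fill C ps c : entails ps c ->
  logic L (Imp (conj_of [seq interp (fill C p) | p <- ps]) (interp (fill C c))).
Proof.
move=> e.
have base : logic L (Imp (conj_of (map formula_of ps)) (formula_of c)).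
  by apply: LogTaut => v w; apply/beval_impP; rewrite beval_conj; exact: e.
have or_case X :
    logic L (Imp (conj_of [seq Or (formula_of p) X | p <- ps]) (Or (formula_of c) X)).
  apply: (logic_cons1 base) => v w /beval_impP h; apply/beval_impP.
  rewrite beval_conj all_map => hall; apply/orP.
  case: (boolP (beval v w X)) => nX; [by right|left]; apply: h.
  rewrite beval_conj all_map; apply: sub_all hall => p /=.
  by rewrite (negbTE nX) orbF.
elim: C => [|t|X|t|s C IH] //=; try exact: or_case.
  by rewrite (map_comp (fun X => Or (formula_of t) (Box X)) formula_of);
    apply: logic_or_box_conj.
by rewrite (map_comp (fun X => Or (formula_of s) (Box X))
              (fun p => interp (fill C p))); apply: logic_or_box_conj.
Qed.

(** Here [t'] is only known under a box and need not be a theorem, so [X] is detached inside the box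
    by K. *)
Lemma moves_interp s t' s' t : moves L s t' s' t ->
  logic L (Imp (interp (Next s (Single t'))) (interp (Trans s' t))).
Proof.
case=> X [ht hs' hss'].
have h : logic L (Imp (Box (formula_of t')) (Box (Imp X (formula_of t)))).
  by apply: logic_RM_taut => v w /ht hX; exact/beval_impP.
apply: (logic_cons (As := [:: Imp (Box (formula_of t'))
    (Box (Imp X (formula_of t))); Or (formula_of s') (Box X);
    Imp (Box (Imp X (formula_of t))) (Imp (Box X) (Box (formula_of t)))])) => [A|].
  rewrite !inE => /or3P[] /eqP-> //; exact: (logic_K hC).
move=> v w /and4P[/beval_impP h1 /orP h2 /beval_impP h3 _]; apply/beval_impP => /orP h4.
apply/orP; case: h2 => [|hX]; first by left.
case: h4 => [vs|/h1/h3/beval_impP/(_ hX)]; last by right.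
by left; apply: hss'; rewrite all_formula_of_cons; apply/andP.
Qed.

Lemma interp_sound X : derivable (with_struct (LNS L)) X -> logic L (interp X).
Proof.
have fill_sound C ps c : entails ps c ->
    (forall p, List.In p ps -> logic L (interp (fill C p))) ->
    logic L (interp (fill C c)).
  move=> e h; apply: (logic_cons2 (interp_fill C e) (_ : logic L _)); last first.
    by move=> v w /beval_impP; exact.
  apply: (logic_cons (As := [seq interp (fill C p) | p <- ps])) => [A|v w]; last first.
    by rewrite beval_conj.
  elim: (ps) h => [//|p qs IH] h; rewrite inE => /orP[/eqP->|]; first by apply: h; left.
  by apply: IH => q qqs; apply: h; right.
elim=> {X} Xs Y r _.
case: r => {Xs Y} [Xs Y r|C p c sr] h; last first.
  apply: (fill_sound _ _ _ (struct_rule_sound sr)).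
  by move=> q [<-|//]; apply: h; left.
case: r h => {Xs Y} [C ps c bC r|H B G D|H A G D G' D'|a X Y aL r] h.
- apply: (fill_sound _ _ _ (prop_rule_sound r)).
  by move=> p pps; apply: h; apply: List.in_map.
- have := h _ (or_introl erefl); apply: LogMP; apply: interp_prefix.
  exact: opens_boxR.
- have := h _ (or_introl erefl); apply: LogMP; apply: interp_prefix.
  exact: moves_interp (moves_boxL L A G D G' D').
have {h} := h _ (or_introl erefl); apply: LogMP.
case: r aL => [H s G D|H s G D|H G D|H A G D|H A G D G' D'|H A G D G' D'] aL;
  apply: interp_prefix.
- by apply: LogTaut => v w; apply/beval_impP.
- by apply: LogTaut => v w; apply/beval_impP.
- exact: opens_P.
- exact: opens_D.
- exact: moves_interp (moves_4 A G D G' D' aL).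
exact: moves_interp (moves_5 A G D G' D' aL).
Qed.

End NormalSoundness.

Lemma lns_sound (L : {set axiom_name}) A : regular L ->
  derivable (with_struct (LNS L)) (Single (mset0 ⇒ [mset A])) -> logic L A.
Proof.
move=> /and5P[_ /eqP hCN _ _ _] d.
have h : logic L (formula_of (mset0 ⇒ [mset A])).
  have [hC|hC] := boolP (AxC \in L); first by apply: (interp_sound _ _ d) => //; rewrite -hCN.
  by apply: (some_valid_sound hC _ d); rewrite -hCN.
apply: (logic_cons1 h) => v w.
by rewrite beval_formula_of all_mset0 has_mset1.
Qed.

Lemma regular_listed (L : {set axiom_name}) :
  L \in [:: M5; MP5; M45; MP45; MD45; K45; KD45] -> regular L.
Proof.
have axiom_eqE (a b : axiom_name) : (a == b) =
    match a, b with
    | AxC, AxC | AxN, AxN | AxP, AxP | AxD, AxD | Ax4, Ax4 | Ax5, Ax5 => true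
    | _, _ => false
    end by apply/eqP; case: a; case: b.
rewrite !inE /regular => hL.
by repeat (case/orP: hL => hL); rewrite (eqP hL) !inE !axiom_eqE.
Qed.

Theorem mainTheorem14 (L : {set axiom_name})
  (hL : L \in [:: M5; MP5; M45; MP45; MD45; K45; KD45]) (A : formula) :
  logic L A <->
  derivable (with_struct (LNS L)) (Single (mset0 ⇒ [mset A])).
Proof.
have reg := regular_listed hL; split; last exact: lns_sound.
move=> /(logic_der reg) /(der_prov reg); rewrite /sequent_of !lhs_rhs_cons.
by rewrite lhs_nil rhs_nil msetD0.
Qed.
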